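(* Let $X$ and $Y$ be uniformly perfect metric spaces, each with more than one point, let $\Phi$ be an admissible function, let $F\subseteq X$ be non-empty and totally bounded, let $f\colon F\to Y$ be Lipschitz, and assume that $\dim_{\mathrm A}f(F)<\infty$. Then: 1. $\overline{\dim}^\Phi f(F)\le\overline{\dim}^\Phi F$ and $\underline{\dim}^\Phi f(F)\le\underline{\dim}^\Phi F$. 2. If moreover $f$ is bi-Lipschitz (Lipschitz with a Lipschitz inverse $f(F)\to F$), then $\overline{\dim}^\Phi f(F)=\overline{\dim}^\Phi F$ and $\underline{\dim}^\Phi f(F)=\underline{\dim}^\Phi F$.
   Context: For a subset $U$ of a metric space, $|U|$ denotes its diameter, and $B(x,r)$ is the open ball. Convention: $\inf\varnothing=\infty$. A metric space $X$ is uniformly perfect if there is $c\in(0,1)$ such that $B(x,R)\setminus B(x,cR)\neq\varnothing$ for all $x\in X$ and $0<R<|X|$. $N_\delta(F)$ is the smallest number of open balls of radius $\delta/2$ with centres in $F$ needed to cover $F$; $F$ is totally bounded if $N_\delta(F)<\infty$ for all $\delta>0$. A function $\Phi\colon(0,\Delta)\to\mathbb{R}$ (for some $\Delta>0$) is admissible if it is monotonic, $0<\Phi(\delta)\le\delta$ for all $\delta\in(0,\Delta)$, and $\Phi(\delta)/\delta\to0$ as $\delta\to0^+$. For a non-empty totally bounded subset $F$ of a metric space $X$ and admissible $\Phi$, the upper $\Phi$-intermediate dimension $\overline{\dim}^\Phi F$ is the infimum of all $s\ge0$ such that for all $\epsilon>0$ there exists $\delta_0\in(0,1]$ (with $(0,\delta_0)$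 contained in the domain of $\Phi$) such that for all $\delta\in(0,\delta_0)$ there is a finite or countable cover $\{U_1,U_2,\dots\}$ of $F$ by subsets of the ambient space with $\Phi(\delta)\le|U_i|\le\delta$ for all $i$ and $\sum_i|U_i|^s\le\epsilon$. The lower $\Phi$-intermediate dimension $\underline{\dim}^\Phi F$ is the infimum of all $s\ge0$ such that for all $\epsilon>0$ and $\delta_0\in(0,1]$ there exist $\delta\in(0,\delta_0)$ (in the domain of $\Phi$) and such a cover of $F$ with $\Phi(\delta)\le|U_i|\le\delta$ for all $i$ and $\sum_i|U_i|^s\le\epsilon$. (For $f(F)$ the ambient space is $Y$.) The Assouad dimension $\dim_{\mathrm A}E$ is the infimum of all $a$ for which there exists $C>0$ such that $N_r(B(x,R)\cap E)\le C(R/r)^a$ for all $x\in E$ and $0<r<R$. *)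

(* Defs.v *)
From mathcomp Require Import all_boot all_order all_algebra.
From mathcomp Require Import all_classical all_reals all_analysis.

Set Implicit Arguments.
Unset Strict Implicit.
Unset Printing Implicit Defensive.

Import Order.TTheory GRing.Theory Num.Theory.
Import numFieldNormedType.Exports.

Local Open Scope classical_set_scope.
Local Open Scope ring_scope.

(* The maximum with 0 only matters for the empty set, whose diameter is 0. *)
Definition diam (R : realType) (T : metricType R) (U : set T) : \bar R :=
  maxe 0%E (ereal_sup [set (mdist x y)%:E | x in U & y in U]).

(* [ball x r] is the open ball, by [ballEmdist]. *)
Definition uniformly_perfect (R : realType) (T : metricType R) : Prop :=
  exists c : R, 0 < c < 1 /\
    forall (x : T) (r : R), 0 < r -> (r%:E < diam [set: T])%E ->
      ball x r `\` ball x (c * r) !=set0.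

(* The infimum is +oo when no finite family of balls covers F. *)
Definition covering_number (R : realType) (T : metricType R)
    (delta : R) (F : set T) : \bar R :=
  ereal_inf [set (n%:R)%:E | n in [set n : nat |
    exists c : 'I_n -> T, (forall i, F (c i)) /\
      F `<=` \bigcup_(i in [set: 'I_n]) ball (c i) (delta / 2)]].

Definition totally_bounded_set (R : realType) (T : metricType R)
    (F : set T) : Prop :=
  forall delta : R, 0 < delta -> (covering_number delta F < +oo)%E.

(* Phi represents a function on ]0, Delta[; its values elsewhere are
   irrelevant here and in the dimensions below. *)
Definition admissible (R : realType) (Delta : R) (Phi : R -> R) : Prop :=
  [/\ 0 < Delta,
      {in `]0, Delta[ &, {homo Phi : x y / x <= y}} \/
      {in `]0, Delta[ &, {homo Phi : x y / x <= y >-> y <= x}},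
      (forall delta : R, 0 < delta < Delta -> 0 < Phi delta <= delta) &
      Phi delta / delta @[delta --> 0^'+] --> (0 : R)].

(* The index set D : set nat makes the cover (U i), i in D, finite or
   countably infinite. *)
Definition has_cover (R : realType) (T : metricType R) (Phi : R -> R)
    (F : set T) (s eps delta : R) : Prop :=
  exists (D : set nat) (U : nat -> set T),
    [/\ F `<=` \bigcup_(i in D) U i,
        (forall i, D i ->
          ((Phi delta)%:E <= diam (U i))%E /\ (diam (U i) <= delta%:E)%E) &
        (\esum_(i in D) (diam (U i) `^ s)%E <= eps%:E)%E].

Definition upper_dim (R : realType) (T : metricType R) (Delta : R)
    (Phi : R -> R) (F : set T) : \bar R :=
  ereal_inf [set s%:E | s in [set s : R | 0 <= s /\
    forall eps : R, 0 < eps ->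
      exists delta0 : R, [/\ 0 < delta0 <= 1, delta0 <= Delta &
        forall delta : R, 0 < delta < delta0 -> has_cover Phi F s eps delta]]].

Definition lower_dim (R : realType) (T : metricType R) (Delta : R)
    (Phi : R -> R) (F : set T) : \bar R :=
  ereal_inf [set s%:E | s in [set s : R | 0 <= s /\
    forall eps delta0 : R, 0 < eps -> 0 < delta0 <= 1 ->
      exists delta : R, [/\ 0 < delta < delta0, delta < Delta &
        has_cover Phi F s eps delta]]].

Definition assouad_dim (R : realType) (T : metricType R) (E : set T) : \bar R :=
  ereal_inf [set a%:E | a in [set a : R | exists C : R, 0 < C /\
    forall (x : T) (r rho : R), E x -> 0 < r < rho ->
      (covering_number r (ball x rho `&` E) <= (C * (rho / r) `^ a)%:E)%E]].

Definition lipschitz_in (R : realType) (S T : metricType R) (A : set S)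
    (f : S -> T) : Prop :=
  exists L : R, forall x y, A x -> A y -> mdist (f x) (f y) <= L * mdist x y.

(* The inverse f(A) -> A is the restriction of g to f(A). *)
Definition bilipschitz_in (R : realType) (S T : metricType R) (A : set S)
    (f : S -> T) : Prop :=
  lipschitz_in A f /\
  exists g : T -> S, (forall x, A x -> g (f x) = x) /\ lipschitz_in (f @` A) g.

(* Main.v *)
(* Take a cover (U_i) of F with Phi(delta) <= |U_i| <= delta.  Since f(F) is
   doubling, each f(U_i) is covered by M balls of radius |U_i|/4, with M
   independent of i and delta.  Such a ball may have diameter below Phi(delta),
   so one adds to it a point at distance comparable to min(|U_i|, delta) from
   its centre; uniform perfectness of Y provides one, and as
   Phi(delta)/delta -> 0 the enlarged sets have diameter between Phi(delta) and
   min(delta, K |U_i|) once delta is small.  This multiplies the s-sum by at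
   most M K^s.  For the bi-Lipschitz part, finiteness of the Assouad dimension
   passes from f(F) to F, and the same argument applies to the inverse. *)
Require Import Defs.
From mathcomp Require Import all_boot all_order all_algebra.
From mathcomp Require Import all_classical all_reals all_analysis.
From mathcomp Require Import ring lra.

Import Order.TTheory GRing.Theory Num.Theory.
Import numFieldNormedType.Exports.

Local Open Scope classical_set_scope.

Section LipschitzImages.
Local Open Scope ring_scope.
Context {R : realType}.

(** * Diameters, sums and annuli *)

Lemma diam_ge0 {T : metricType R} (U : set T) : (0 <= diam U)%E.
Proof. by rewrite /diam le_max lexx. Qed.

Lemma mdist_le_diam {T : metricType R} {U : set T} {x y : T} :
  U x -> U y -> ((mdist x y)%:E <= diam U)%E.
Proof.
move=> Ux Uy; rewrite /diam le_max; apply/orP; right.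
by apply: ereal_sup_ubound; exists x => //; exists y.
Qed.

Lemma diam_le {T : metricType R} {U : set T} {d : R} : 0 <= d ->
  (forall x y, U x -> U y -> mdist x y <= d) -> (diam U <= d%:E)%E.
Proof.
move=> d0 Ud; rewrite /diam ge_max lee_fin d0 /=.
by apply: ge_ereal_sup => _ [x Ux [y Uy <-]]; rewrite lee_fin; exact: Ud.
Qed.

Lemma esum_mulel {I : choiceType} (D : set I) (c : \bar R) (a : I -> \bar R) :
  (0 <= c)%E -> (forall i, 0 <= a i)%E ->
  (\esum_(i in D) (c * a i) <= c * \esum_(i in D) a i)%E.
Proof.
move=> c0 a0; apply: ge_ereal_sup => _ [A [finA AD] <-].
rewrite -ge0_mule_fsumr//; apply: lee_wpmul2l => //.
by apply: ereal_sup_ubound; exists A.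
Qed.

(** The distance between two distinct points never exceeds the diameter of the space, so it serves
    as a real threshold for radii even when that diameter is infinite. *)
Lemma uniformly_perfect_annulus {T : metricType R} : uniformly_perfect T ->
  (exists x y : T, x <> y) ->
  exists c d0 : R, [/\ 0 < c < 1, 0 < d0 & forall (x : T) (r : R), 0 < r < d0 ->
    exists z, c * r <= mdist x z < r].
Proof.
move=> [c [c01 hc]] [a [b /eqP ab]]; exists c, (mdist a b).
split => //; first by rewrite mdist_gt0.
move=> x r /andP[r0 rd].
have [|z [/=]] := hc x r r0.
  by apply: lt_le_trans (mdist_le_diam (U := setT) (x := a) (y := b) _ _); rewrite ?lte_fin.
rewrite !ballEmdist /= => zr /negP; rewrite -leNgt => zc.
by exists z; rewrite zc zr.
Qed.

(** * Lipschitz constants, covering numbers and Assouad dimension *)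

Lemma lipschitz_in_ge1 {S T : metricType R} {F : set S} {f : S -> T} :
  lipschitz_in F f -> exists2 L : R, 1 <= L &
    forall x y, F x -> F y -> mdist (f x) (f y) <= L * mdist x y.
Proof.
move=> [L fL]; exists (Num.max 1 L); first by rewrite le_max lexx.
move=> x y Fx Fy; apply: le_trans (fL x y Fx Fy) _.
by apply: ler_wpM2r; rewrite ?mdist_ge0// le_max lexx orbT.
Qed.

Lemma covering_number_leP {T : metricType R} {r b : R} {F : set T} :
  (covering_number r F <= b%:E)%E -> exists n : nat, n%:R < b + 1 /\
    exists c : 'I_n -> T, F `<=` \bigcup_(i in [set: 'I_n]) ball (c i) (r / 2).
Proof.
move=> Fb.
(* The slack of 1 makes the inequality strict, so some actual cover stays below the bound. *)
have /ereal_inf_lt[_ [n [c [_ Fc] <-] nb]] : (covering_number r F < (b + 1)%:E)%E.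
  by apply: le_lt_trans Fb _; rewrite lte_fin ltrDl.
by exists n; split; [rewrite lte_fin in nb | exists c].
Qed.

(** For two radii in the fixed ratio [l], the Assouad bound becomes C l^a, which depends neither on
    the point nor on the scale. *)
Lemma assouad_dim_doubling {T : metricType R} {E : set T} {l : R} :
  (assouad_dim E < +oo)%E -> 1 < l ->
  exists M : nat, forall (x : T) (r : R), E x -> 0 < r ->
    exists c : nat -> T,
      ball x (l * r) `&` E `<=` \bigcup_(j in `I_M) ball (c j) (r / 2).
Proof.
move=> /ereal_inf_lt[_ [a [C [C0 EC] <-] _]] l1.
exists (Num.Def.archi_bound (C * l `^ a + 1)) => x r Ex r0.
have /EC : 0 < r < l * r by rewrite r0 ltr_pMl.
move=> /(_ x Ex) /covering_number_leP[n [nC [c Ec]]].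
rewrite mulfK ?gt_eqF// in nC.
(* Indices from [n] on get the dummy centre [x], so that one [M] serves all balls. *)
exists (fun j => oapp c x (insub j)) => y /Ec[i _ yi].
exists (i : nat); last by rewrite /= valK.
apply: leq_trans (ltn_ord i) _; rewrite -(ler_nat R); apply/ltW/(lt_trans nC).
by apply: archi_boundP; rewrite addr_ge0// mulr_ge0 ?powR_ge0// ltW.
Qed.

(** The image of a ball of radius [rho] lies in one of radius [L * rho]. Covering it by balls of
    radius r/(4G) and pulling back by [g] gives pieces whose points are less than r/2 apart. The
    exponent [a] is kept, and the ratio of scales grows by the factor 2LG. *)
Lemma assouad_dim_bilipschitz {S T : metricType R} {F : set S} {f : S -> T} :
  bilipschitz_in F f -> (assouad_dim (f @` F) < +oo)%E ->
  (assouad_dim F < +oo)%E.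
Proof.
move=> [/lipschitz_in_ge1[L L1 fL] [g [gf /lipschitz_in_ge1[G G1 gG]]]].
move=> /ereal_inf_lt[_ [a [C [C0 EC] <-] _]].
apply: le_lt_trans (ltry a); apply: ereal_inf_lbound; exists a => //.
exists (C * (2 * L * G) `^ a); split.
  by rewrite mulr_gt0// powR_gt0// !mulr_gt0//; lra.
move=> x r rho Fx /andP[r0 rrho].
have L0 : 0 < L by lra.
have G0 : 0 < G by lra.
have rG : 0 < r / (2 * G) < L * rho.
  rewrite divr_gt0 ?mulr_gt0//= ltr_pdivrMr ?mulr_gt0//.
  have LG : 1 <= L * G by rewrite mulr_ege1.
  have -> : L * rho * (2 * G) = 2 * (L * G * rho) by ring.
  nra.
have -> : C * (2 * L * G) `^ a * (rho / r) `^ a =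
    C * (L * rho / (r / (2 * G))) `^ a.
  rewrite -mulrA -powRM; last 2 first.
  - by rewrite !mulr_ge0 ?ltW.
  - by rewrite divr_ge0//; lra.
  by congr (_ * _ `^ _); field; rewrite !gt_eqF.
apply: le_trans (EC (f x) _ _ _ rG); last by exists x.
apply: le_ereal_inf => _ [n [c [_ Ec]] <-]; exists n => //.
(* The preimage of a ball need not contain the preimage of its centre, so it
   is recentred at one of its own points, at the cost of doubling its radius. *)
have /choice[p hp] : forall i : 'I_n, exists p : S, (ball x rho `&` F) p /\
    ((exists q, (ball x rho `&` F) q /\ ball (c i) (r / (2 * G) / 2) (f q)) ->
     ball (c i) (r / (2 * G) / 2) (f p)).
  move=> i; have [[q [xq cq]]|nq] := pselect (exists q,
    (ball x rho `&` F) q /\ ball (c i) (r / (2 * G) / 2) (f q)).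
    by exists q.
  by exists x; split => //; split => //; apply: ballxx; lra.
exists p; split; first by move=> i; have [] := hp i.
move=> y [xy Fy].
have [|i _ ci] := Ec (f y).
  split; last by exists y.
  move: xy; rewrite !ballEmdist /= => xy.
  by apply: le_lt_trans (fL _ _ Fx Fy) _; rewrite ltr_pM2l.
exists i => //; have [[_ Fp] /(_ (ex_intro _ y (conj (conj xy Fy) ci)))] := hp i.
move: ci; rewrite !ballEmdist /= => cy cp.
rewrite -(gf _ Fp) -(gf _ Fy).
apply: le_lt_trans (gG _ _ (imageP _ Fp) (imageP _ Fy)) _.
rewrite mulrC -ltr_pdivlMr//.
have -> : r / 2 / G = r / (2 * G) / 2 + r / (2 * G) / 2 by field; rewrite gt_eqF.
apply: le_lt_trans (metric_triangle _ (c i) _) _.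
by rewrite (metric_sym (f (p i))); exact: ltrD.
Qed.

(** * The image of a single covering set *)

Lemma diam_ball_point {T : metricType R} {x z : T} {r d : R} :
  0 < r -> 2 * r <= d -> r + mdist x z <= d ->
  (diam (ball x r `|` [set z]) <= d%:E)%E.
Proof.
move=> r0 rd rzd; apply: diam_le => [|u v]; first by lra.
rewrite ballEmdist /= => -[xu|->] [xv|->].
- by have := metric_triangle u x v; rewrite (metric_sym u x); lra.
- by have := metric_triangle u x z; rewrite (metric_sym u x); lra.
- by have := metric_triangle z x v; rewrite (metric_sym z x); lra.
- by rewrite mdistxx; lra.
Qed.

Lemma admissible_small {Delta : R} {Phi : R -> R} {c : R} :
  admissible Delta Phi -> 0 < c ->
  exists2 d0, 0 < d0 & forall d, 0 < d < d0 -> Phi d <= c * d.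
Proof.
move=> [_ _ _ cvgPhi] c0.
have /cvgrPdist_le/(_ _ c0)[e /= e0 he] := cvgPhi.
exists e => // d /andP[d0 de]; have := he d.
rewrite /= !sub0r !normrN => /(_ _ d0); rewrite gtr0_norm // => /(_ de).
by move=> /(le_trans (ler_norm _)); rewrite ler_pdivrMr.
Qed.

Lemma lipschitz_image_pieces {S T : metricType R} {Delta : R} {Phi : R -> R}
    {F : set S} {f : S -> T} :
  uniformly_perfect T -> (exists x y : T, x <> y) -> admissible Delta Phi ->
  F !=set0 -> lipschitz_in F f -> (assouad_dim (f @` F) < +oo)%E ->
  exists (M : nat) (K d0 : R), [/\ 0 < K, 0 < d0 &
    forall (delta d : R) (U : set S), 0 < delta < d0 -> 0 < d ->
      diam U = d%:E -> Phi delta <= d <= delta ->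
      exists W : nat -> set T, f @` (U `&` F) `<=` \bigcup_(j in `I_M) W j /\
        forall j, [/\ ((Phi delta)%:E <= diam (W j))%E,
                      (diam (W j) <= delta%:E)%E &
                      (diam (W j) <= (K * d)%:E)%E]].
Proof.
move=> hT hT2 hPhi [p0 Fp0] /lipschitz_in_ge1[L L1 fL] hA.
have [c [t0 [/andP[c0 c1] t00 hc]]] := uniformly_perfect_annulus hT hT2.
(* The image of a set of diameter [d] lies in an open ball of radius 2Ld, which is 4L times d/2; the
   covering balls then have radius d/4. *)
have [M hM] : exists M : nat, forall (x : T) (r : R), (f @` F) x -> 0 < r ->
    exists z : nat -> T,
      ball x (4 * L * r) `&` f @` F `<=` \bigcup_(j in `I_M) ball (z j) (r / 2).
  by apply: assouad_dim_doubling => //; lra.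
have [d1 d10 hd1] : exists2 d1, 0 < d1 & forall d, 0 < d < d1 -> Phi d <= c / 2 * d.
  by apply: admissible_small hPhi _; lra.
(* A ball of radius d/4 together with a point at distance less than d/c from its centre has diameter
   at most (1/c + 1)d. *)
exists M, (c^-1 + 1), (Num.min t0 d1); split.
- by rewrite addr_gt0 ?invr_gt0.
- by rewrite lt_min t00.
move=> delta d U /andP[delta0]; rewrite lt_min => /andP[deltat delta1] d0 Ud.
move=> /andP[Phid ddelta].
have [p [Fp Up]] : exists p, F p /\ f @` (U `&` F) `<=` ball (f p) (4 * L * (d / 2)).
  have [[p [Up Fp]]|nUF] := pselect (U `&` F !=set0).
    exists p; split => // _ [q [Uq Fq] <-]; rewrite ballEmdist /=.
    apply: le_lt_trans (fL _ _ Fp Fq) _.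
    have : mdist p q <= d by rewrite -lee_fin -Ud; exact: mdist_le_diam.
    by nra.
  (* If [U] misses [F], the image is empty and any point of [F] will do. *)
  by exists p0; split => // y [q Uq _]; case: nUF; exists q.
have [|z hz] := hM (f p) (d / 2) (imageP _ Fp); first by lra.
(* The added point lies at distance at least cr = min(d, c delta/2), and both terms are at least
   [Phi delta]. The bound r <= delta/2 keeps the diameter within d/4 + delta/2 <= delta. *)
pose r := Num.min (d / c) (delta / 2).
have r0 : 0 < r by rewrite lt_min !divr_gt0.
have rd : r <= d / c by rewrite ge_min lexx.
have rdelta : r <= delta / 2 by rewrite ge_min lexx orbT.
have /choice[w hw] : forall j, exists w, c * r <= mdist (z j) w < r.
  by move=> j; apply: hc; lra.
exists (fun j => ball (z j) (d / 2 / 2) `|` [set w j]); split.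
  move=> y UFy; have [|j Mj yj] := hz y; last by exists j => //; left.
  by split; [exact: Up | case: UFy => q [_ Fq] <-; exists q].
move=> j; have /andP[cw wr] := hw j; split.
- apply: le_trans (mdist_le_diam (x := z j) (y := w j) _ _); last 2 first.
  + by left; apply: ballxx; lra.
  + by right.
  rewrite lee_fin; apply: le_trans cw.
  rewrite /r minr_pMr ?(ltW c0)// le_min mulrC divfK ?gt_eqF// Phid /=.
  have := hd1 delta; rewrite delta0 delta1 => /(_ isT).
  by rewrite mulrAC mulrA.
- by apply: diam_ball_point; lra.
- by rewrite mulrDl mul1r (mulrC c^-1); apply: diam_ball_point; lra.
Qed.

(** * The image of a whole cover *)

Lemma esum_divn {D : set nat} {M : nat} {a : nat -> \bar R} : (0 < M)%N ->
  (forall i, 0 <= a i)%E ->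
  (\esum_(k in [set k | D (k %/ M)%N]) a (k %/ M)%N <=
   M%:R%:E * \esum_(i in D) a i)%E.
Proof.
move=> M0 a0.
(* Euclidean division by [M] identifies [k] with a pair (i, j) with j < M, so each term of the
   original sum occurs exactly [M] times. *)
have bij : set_bij (D `*` `I_M) [set k | D (k %/ M)%N]
    (fun ij : nat * nat => (ij.1 * M + ij.2)%N).
  split => [[i j] /= [Di jM]|[i j] [i' j']|k Dk].
  - by rewrite divnMDl// divn_small// addn0.
  - rewrite !inE /= => -[_ jM] [_ jM'] e.
    have := congr1 (divn^~ M) e; rewrite !divnMDl// !divn_small// !addn0 => ->.
    by have := congr1 (modn^~ M) e; rewrite !modnMDl !modn_small// => ->.
  - exists (k %/ M, k %% M)%N => /=; last by rewrite -divn_eq.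
    by split => //=; rewrite ltn_mod.
rewrite (reindex_esum _ _ _ _ bij).
rewrite (eq_esum (b := fun ij => a ij.1)); last first.
  by move=> [i j] /= [_ jM]; rewrite divnMDl// divn_small// addn0.
rewrite -(@esum_esum _ _ _ D (fun=> `I_M) (fun i _ => a i))//.
rewrite (eq_esum (b := fun i => M%:R%:E * a i)%E).
  by apply: esum_mulel => //; rewrite lee_fin.
move=> i _; rewrite esum_fset// -fsbig_ord sumr_const card_ord.
by rewrite mule_natl.
Qed.

Lemma has_cover_image {S T : metricType R} {Delta : R} {Phi : R -> R}
    {F : set S} {f : S -> T} :
  uniformly_perfect T -> (exists x y : T, x <> y) -> admissible Delta Phi ->
  F !=set0 -> lipschitz_in F f -> (assouad_dim (f @` F) < +oo)%E ->
  exists M K d0 : R, [/\ 0 < M, 0 < K, 0 < d0 &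
    forall s eps delta : R, 0 <= s -> 0 < delta < d0 -> delta < Delta ->
      has_cover Phi F s eps delta ->
      has_cover Phi (f @` F) s (M * K `^ s * eps) delta].
Proof.
move=> hT hT2 hPhi hF hf hA.
have [M [K [d0 [K0 d00 hW]]]] := lipschitz_image_pieces hT hT2 hPhi hF hf hA.
(* [M] is not known to be positive, while the indexing by quotient and remainder needs a positive
   divisor. The surplus piece is harmless, as the diameter bounds hold for every index. *)
exists M.+1%:R, K, d0; split => // s eps delta s0 deltad0 deltaD [D [U [FU dU sU]]].
have [_ _ /(_ delta) hPhi0 _] := hPhi.
have /andP[Phi0 _] : 0 < Phi delta <= delta by apply: hPhi0; case/andP: deltad0 => ->.
have /choice[W W_spec] : forall i, exists W : nat -> set T, D i ->
    f @` (U i `&` F) `<=` \bigcup_(j in `I_M) W j /\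
    forall j, [/\ ((Phi delta)%:E <= diam (W j))%E,
                  (diam (W j) <= delta%:E)%E &
                  (diam (W j) <= K%:E * diam (U i))%E].
  move=> i; have [Di|nDi] := pselect (D i); last by exists (fun=> set0).
  have [PU Ud] := dU i Di.
  have dUE : diam (U i) = (fine (diam (U i)))%:E.
    by rewrite fineK// fin_numE; apply/andP; split; apply/eqP => e;
      rewrite e in PU Ud.
  move: PU Ud; rewrite dUE !lee_fin => PU Ud.
  have [||V [UV hV]] := hW delta _ (U i) deltad0 _ dUE.
  - exact: lt_le_trans PU.
  - by rewrite PU.
  by exists V.
have M0 : (0 < M.+1)%N by [].
exists [set k | D (k %/ M.+1)%N], (fun k => W (k %/ M.+1)%N (k %% M.+1)%N); split.
- move=> _ [x Fx <-]; have [i Di Uix] := FU x Fx.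
  have [j jM Wj] := (W_spec i Di).1 (f x) (imageP f (conj Uix Fx)).
  have jM1 : (j < M.+1)%N by exact: ltnW.
  exists (i * M.+1 + j)%N; rewrite /= divnMDl// divn_small// addn0//.
  by rewrite modnMDl modn_small.
- by move=> k /= /W_spec[_ /(_ (k %% M.+1)%N)[]].
apply: (@le_trans _ _ (\esum_(k in [set k | D (k %/ M.+1)%N])
   ((K `^ s)%:E * (diam (U (k %/ M.+1)%N) `^ s)))%E).
  apply: le_esum => k /= /W_spec[_ /(_ (k %% M.+1)%N)[_ _ WK]].
  rewrite -poweR_EFin -poweRM ?diam_ge0 ?lee_fin ?(ltW K0)//.
  by apply: gt0_ler_poweR; rewrite ?in_itv/= ?leey ?mule_ge0 ?diam_ge0 ?lee_fin ?(ltW K0).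
apply: le_trans (esum_divn (a := fun i => (K `^ s)%:E * diam (U i) `^ s)%E M0 _) _.
  by move=> i; rewrite mule_ge0 ?lee_fin ?powR_ge0 ?poweR_ge0.
rewrite -mulrA EFinM; apply: lee_wpmul2l; first by rewrite lee_fin.
apply: le_trans (esum_mulel _ _ _ _ _) _; rewrite ?lee_fin ?powR_ge0//.
  by move=> i; exact: poweR_ge0.
by rewrite EFinM; apply: lee_wpmul2l => //; rewrite lee_fin powR_ge0.
Qed.

(** * Comparison of the dimensions *)

Lemma upper_dim_lipschitz {S T : metricType R} {Delta : R} {Phi : R -> R}
    {F : set S} {f : S -> T} :
  uniformly_perfect T -> (exists x y : T, x <> y) -> admissible Delta Phi ->
  F !=set0 -> lipschitz_in F f -> (assouad_dim (f @` F) < +oo)%E ->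
  (upper_dim Delta Phi (f @` F) <= upper_dim Delta Phi F)%E.
Proof.
move=> hT hT2 hPhi hF hf hA.
have [M [K [d0 [M0 K0 d00 hcov]]]] := has_cover_image hT hT2 hPhi hF hf hA.
apply: le_ereal_inf => _ [s [s0 Fs] <-]; exists s => //; split => // eps eps0.
have MK0 : 0 < M * K `^ s by rewrite mulr_gt0// powR_gt0.
(* The loss factor M K^s depends neither on [eps] nor on the scale, so it is absorbed by shrinking
   [eps] beforehand. *)
have [|d1 [/andP[d10 d1le1] d1D Fd1]] := Fs (eps / (M * K `^ s)).
  by rewrite divr_gt0.
exists (Num.min d0 d1); split.
- by rewrite lt_min d00 d10 ge_min d1le1 orbT.
- by rewrite ge_min d1D orbT.
move=> d /andP[dgt0]; rewrite lt_min => /andP[dd0 dd1].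
have -> : eps = M * K `^ s * (eps / (M * K `^ s)) by rewrite mulrC divfK ?gt_eqF.
apply: hcov; rewrite ?dgt0//; first exact: lt_le_trans dd1 d1D.
by apply: Fd1; rewrite dgt0.
Qed.

Lemma lower_dim_lipschitz {S T : metricType R} {Delta : R} {Phi : R -> R}
    {F : set S} {f : S -> T} :
  uniformly_perfect T -> (exists x y : T, x <> y) -> admissible Delta Phi ->
  F !=set0 -> lipschitz_in F f -> (assouad_dim (f @` F) < +oo)%E ->
  (lower_dim Delta Phi (f @` F) <= lower_dim Delta Phi F)%E.
Proof.
move=> hT hT2 hPhi hF hf hA.
have [M [K [d0 [M0 K0 d00 hcov]]]] := has_cover_image hT hT2 hPhi hF hf hA.
apply: le_ereal_inf => _ [s [s0 Fs] <-]; exists s => //; split => // eps d1 eps0.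
move=> /andP[d10 d1le1].
have MK0 : 0 < M * K `^ s by rewrite mulr_gt0// powR_gt0.
(* Good scales for [F] exist below every threshold, in particular below [d0], where covers can be
   transferred to the image. *)
have [|| d [/andP[dgt0]]] := Fs (eps / (M * K `^ s)) (Num.min d0 d1).
- by rewrite divr_gt0.
- by rewrite lt_min d00 d10 ge_min d1le1 orbT.
rewrite lt_min => /andP[dd0 dd1] dD Fd; exists d; split => //; first by rewrite dgt0.
have -> : eps = M * K `^ s * (eps / (M * K `^ s)) by rewrite mulrC divfK ?gt_eqF.
by apply: hcov; rewrite ?dgt0.
Qed.

End LipschitzImages.

Local Open Scope ereal_scope.

(* The map f : F -> Y is represented by a total function, of which only the
   restriction to F is used. *)
Theorem corollary4p3 (R : realType) (X Y : metricType R)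
    (hX : uniformly_perfect X) (hY : uniformly_perfect Y)
    (hX2 : exists x y : X, x <> y) (hY2 : exists x y : Y, x <> y)
    (Delta : R) (Phi : R -> R) (hPhi : admissible Delta Phi)
    (F : set X) (hF0 : F !=set0) (hF : totally_bounded_set F)
    (f : X -> Y) (hf : lipschitz_in F f)
    (hA : assouad_dim (f @` F) < +oo) :
  (upper_dim Delta Phi (f @` F) <= upper_dim Delta Phi F /\
   lower_dim Delta Phi (f @` F) <= lower_dim Delta Phi F) /\
  (bilipschitz_in F f ->
   upper_dim Delta Phi (f @` F) = upper_dim Delta Phi F /\
   lower_dim Delta Phi (f @` F) = lower_dim Delta Phi F).
Proof.
have fup := upper_dim_lipschitz hY hY2 hPhi hF0 hf hA.
have flow := lower_dim_lipschitz hY hY2 hPhi hF0 hf hA.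
split=> // bif; have hAF := assouad_dim_bilipschitz bif hA.
have [_ [g [gf hg]]] := bif.
have gfF : g @` (f @` F) = F.
  rewrite eqEsubset; split => [_ [_ [x Fx <-] <-]|x Fx]; first by rewrite gf.
  by exists (f x); [exists x | exact: gf].
have fF0 : f @` F !=set0 by have [x Fx] := hF0; exists (f x); exists x.
rewrite -gfF in hAF.
have := upper_dim_lipschitz hX hX2 hPhi fF0 hg hAF.
have := lower_dim_lipschitz hX hX2 hPhi fF0 hg hAF.
by rewrite gfF => glow gup; split; apply/eqP; rewrite eq_le ?fup ?flow ?gup ?glow.
Qed.
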